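(* Let $\mathfrak{E}=\{x+y\omega\mid x,y\in\mathbb{Z}\}$ with $\omega=-\frac12+\frac{\sqrt3}{2}i$ be the ring of Eisenstein integers, $K=\mathbb{Q}(\omega)$ the subfield generated by $\mathfrak{E}$, $\rho=\frac12+\frac{\sqrt3}{2}i$ and $j=\sqrt3\, i$. Let $f:\mathbb{C}\to\mathfrak{E}$ satisfy $|\zeta-f(\zeta)|\le1$ for all $\zeta\in\mathbb{C}$; let $\Phi=\{\zeta-f(\zeta)\mid\zeta\in\mathbb{C}\setminus K\}$ and $C_f(a)=\{\zeta\in\mathbb{C}\mid f(\zeta)=a\}$ for $a\in\mathfrak{E}$. Suppose that (a) $\Phi\subset B(0,r)$ for some $0<r<1$; (b) $|f(\zeta)|>1$ for all $\zeta\in\Phi^{-1}$; (c) for $0\leq k\leq 5$ and $t\in\{-1+j,\ j,\ 1+j\}$, the sets $\rho^{-k}t+(C_f(\rho^kj))^{-1}$ and $C_f(\rho^{-k}t)\cap\Phi^{-1}$ are disjoint. Let $z\in\mathbb{C}\setminus K$, define $z_0=z$, $z_{n+1}=(z_n-f(z_n))^{-1}$, $a_n=f(z_n)$ ($n\ge0$), and let $\{p_n\},\{q_n\}$ be the $\mathcal{Q}$-pair of $\{a_n\}$. Then: (i) $|q_n|>|q_{n-1}|$ for all $n\geq 1$, and in particular $q_n\neq0$ for all $n$; (ii) $p_n/q_n\to z$ as $n\to\infty$ and $\left|z-\frac{p_n}{q_n}\right|\leq\frac{r}{1-r}|q_n|^{-2}$ for all $n$; (iii) $z$ is a quadratic surd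 over $K$ if and only if $\{a_n\}$ is eventually periodic.
   Context: $B(c,s)$ denotes the open ball of radius $s$ centered at $c$; for a set $S\subset\mathbb{C}^*$, $S^{-1}=\{s^{-1}\mid s\in S\}$, and $c+S=\{c+s\mid s\in S\}$. The $\mathcal{Q}$-pair of $\{a_n\}_{n\ge0}$: $p_{-1}=1$, $p_0=a_0$, $p_{n+1}=a_{n+1}p_n+p_{n-1}$, $q_{-1}=0$, $q_0=1$, $q_{n+1}=a_{n+1}q_n+q_{n-1}$. A quadratic surd over $K$ is a number not in $K$ that is a root of a quadratic polynomial over $K$. *)

(* Defs.v *)
From HB Require Import structures.
From mathcomp Require Import all_boot all_order all_algebra complex.
From mathcomp Require Import all_classical reals topology normedtype sequences.

Set Implicit Arguments.
Unset Strict Implicit.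
Unset Printing Implicit Defensive.

Import Order.TTheory GRing.Theory Num.Theory.
Import numFieldNormedType.Exports.

Local Open Scope classical_set_scope.
Local Open Scope ring_scope.
Local Open Scope complex_scope.

(* The complex numbers are R[i], for R an arbitrary realType.  The norm `|x| *)
(* of x : R[i] is valued in R[i] itself; `x < y' there means that y - x is a *)
(* positive real.  The topology of the complex plane is carried by the alias *)
(* R[i]^o.                                                                   *)

Definition omega (R : realType) : R[i] := (- 2^-1) +i* (Num.sqrt 3 / 2).

Definition rho (R : realType) : R[i] := 2^-1 +i* (Num.sqrt 3 / 2).

Definition jE (R : realType) : R[i] := 0 +i* Num.sqrt 3.

Definition eisenstein (R : realType) : set R[i] :=
  [set u | exists x y : int, u = x%:~R + y%:~R * omega R].

Definition subfield_gen (R : realType) (S : set R[i]) : set R[i] :=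
  smallest (fun T : set R[i] => GRing.divring_closed (mem T)) S.

Definition eisenstein_field (R : realType) : set R[i] :=
  subfield_gen (@eisenstein R).

Definition set_inv (R : realType) (S : set R[i]) : set R[i] :=
  [set s^-1 | s in S].

Definition set_translate (R : realType) (c : R[i]) (S : set R[i]) : set R[i] :=
  [set c + s | s in S].

Definition Phi (R : realType) (f : R[i] -> R[i]) : set R[i] :=
  [set zeta - f zeta | zeta in ~` @eisenstein_field R].

Definition Cset (R : realType) (f : R[i] -> R[i]) (a : R[i]) : set R[i] :=
  [set zeta | f zeta = a].

Definition cf_iter (R : realType) (f : R[i] -> R[i]) (z : R[i]) (n : nat) :
    R[i] :=
  iter n (fun w => (w - f w)^-1) z.

Definition cf_digit (R : realType) (f : R[i] -> R[i]) (z : R[i]) (n : nat) :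
    R[i] :=
  f (cf_iter f z n).

(* Q-pair with indices shifted by one, so as to start at index -1:           *)
(* Qp_shift a n = p_(n-1) and Qq_shift a n = q_(n-1).                        *)
Fixpoint Qp_shift (R : realType) (a : nat -> R[i]) (n : nat) : R[i] :=
  match n with
  | 0 => 1
  | n1.+1 => match n1 with
             | 0 => a 0%N
             | n2.+1 => a n1 * Qp_shift a n1 + Qp_shift a n2
             end
  end.

Fixpoint Qq_shift (R : realType) (a : nat -> R[i]) (n : nat) : R[i] :=
  match n with
  | 0 => 0
  | n1.+1 => match n1 with
             | 0 => 1
             | n2.+1 => a n1 * Qq_shift a n1 + Qq_shift a n2
             end
  end.

Definition Qp (R : realType) (a : nat -> R[i]) (n : nat) : R[i] :=
  Qp_shift a n.+1.

Definition Qq (R : realType) (a : nat -> R[i]) (n : nat) : R[i] :=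
  Qq_shift a n.+1.

Definition quadratic_surd (R : realType) (K : set R[i]) (z : R[i]) : Prop :=
  ~ K z /\
  exists P : {poly R[i]}, [/\ size P = 3, forall i, K P`_i & root P z].

Definition eventually_periodic (T : Type) (u : nat -> T) : Prop :=
  exists n0 m : nat, (0 < m)%N /\ forall n, (n0 <= n)%N -> u (n + m)%N = u n.

(* Main.v *)
(** Write [w_n = q_n / q_(n-1) = a_n + 1 / w_(n-1)].  If [|w_(n-1)| > 1 >= |w_n|]
    then [|a_n|^2 = 3], say [a_n = rho^k j], and [w_(n-1)] lies in a disc of
    radius 1/2 around [rho^-k j / 2]; this leaves [a_(n-1) = rho^-k t] with [t]
    one of [-1 + j, j, 1 + j], which condition (c), applied to
    [z_(n-1) = a_(n-1) + 1 / z_n], forbids.  Hence [|q_n|] increases, and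
    [(q_n z_(n+1) + q_(n-1)) (q_n z - p_n) = +-1] with [|z_(n+1)| > 1/r] gives
    the error bound.  For (iii) one runs Lagrange's argument: the quadratic
    equations of the [z_n] have Eisenstein coefficients that are bounded by the
    error estimate and share one discriminant, so two of the [z_n] coincide;
    conversely, periodic digits force [z_n = z_(n+m)] by convergence. *)

Require Import Defs.
From mathcomp Require Import all_boot all_order all_algebra complex.
From mathcomp Require Import all_classical reals topology normedtype sequences.
From mathcomp Require Import zify ring lra.

Set Implicit Arguments.
Unset Strict Implicit.
Unset Printing Implicit Defensive.

Import Order.TTheory GRing.Theory Num.Theory.
Import numFieldNormedType.Exports.

Local Open Scope classical_set_scope.
Local Open Scope ring_scope.
Local Open Scope complex_scope.

(** * Squared norms of complex numbers, taken in the real field *)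

Section SquaredNorm.
Variable R : realType.
Implicit Types x y : R[i].

(** The norm of [R[i]] is valued in [R[i]]; its square taken in [R] turns comparisons of norms into
    real polynomial inequalities. *)
Definition sqn x : R := complex.Re x ^+ 2 + complex.Im x ^+ 2.

Lemma sqr_norm x : `|x| ^+ 2 = (sqn x)%:C.
Proof. by rewrite -add_Re2_Im2. Qed.

Lemma ltr_norm_sqn x y : (`|x| < `|y|) = (sqn x < sqn y).
Proof.
by rewrite -(@ltr_pXn2r _ 2) ?nnegrE ?normr_ge0 // !sqr_norm ltcR.
Qed.

Lemma ler_norm_sqn x y : (`|x| <= `|y|) = (sqn x <= sqn y).
Proof.
by rewrite -(@ler_pXn2r _ 2) ?nnegrE ?normr_ge0 // !sqr_norm lecR.
Qed.

Lemma sqn1 : sqn 1 = 1.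
Proof. by rewrite /sqn /= expr1n expr0n addr0. Qed.

Lemma ltr1_norm_sqn x : (1 < `|x|) = (1 < sqn x).
Proof. by rewrite -[X in X < _]normr1 ltr_norm_sqn sqn1. Qed.

Lemma sqr_sqrt3 : Num.sqrt 3 ^+ 2 = 3 :> R.
Proof. by rewrite sqr_sqrtr. Qed.

Lemma intr_complex (m : int) : (m%:~R : R[i]) = (m%:~R : R)%:C.
Proof. by rewrite rmorph_int. Qed.

End SquaredNorm.

(** * Eisenstein integers and their field of fractions *)

Section Eisenstein.
Variable R : realType.
Implicit Types (x y : R[i]) (m n : int).

Definition eis m n : R[i] := m%:~R + n%:~R * omega R.

Lemma eisE m n :
  eis m n = (m%:~R - n%:~R / 2) +i* (n%:~R * (Num.sqrt 3 / 2)).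
Proof.
by rewrite /eis !intr_complex /omega; simpc; congr (_ +i* _); field.
Qed.

Lemma sqr_omega : omega R ^+ 2 = - omega R - 1.
Proof.
rewrite /omega expr2; simpc; congr (_ +i* _); last by field.
by have := sqr_sqrt3 R; lra.
Qed.

Lemma eisB m n m' n' : eis m n - eis m' n' = eis (m - m') (n - n').
Proof. by rewrite /eis !intrB; ring. Qed.

Lemma eisM m n m' n' :
  eis m n * eis m' n' = eis (m * m' - n * n') (m * n' + n * m' - n * n').
Proof.
rewrite /eis !(intrB, intrD, intrM).
transitivity (m%:~R * m'%:~R + (m%:~R * n'%:~R + n%:~R * m'%:~R) * omega R
  + n%:~R * n'%:~R * omega R ^+ 2); first by ring.
by rewrite sqr_omega; ring.
Qed.

(** This is the norm form of the Eisenstein integers; it makes size conditions integer inequalities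
    within reach of [lia] and [nia]. *)
Lemma sqn_eis m n : sqn (eis m n) = (m ^+ 2 - m * n + n ^+ 2)%:~R.
Proof.
rewrite eisE /sqn /= !(intrB, intrD, intrM) !exprMn exprVn sqr_sqrt3.
by rewrite !expr2; field.
Qed.

Lemma rhoE : rho R = eis 1 1.
Proof. by rewrite eisE /rho; congr (_ +i* _); field. Qed.

Lemma jEE : jE R = eis 1 2.
Proof. by rewrite eisE /jE; congr (_ +i* _); field. Qed.

Lemma eisenstein1 : eisenstein (1 : R[i]).
Proof. by exists 1, 0; rewrite mul0r addr0. Qed.

Lemma eisenstein0 : eisenstein (0 : R[i]).
Proof. by exists 0, 0; rewrite mul0r addr0. Qed.

Lemma eisensteinB x y : eisenstein x -> eisenstein y -> eisenstein (x - y).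
Proof.
move=> [m [n ->]] [m' [n' ->]]; rewrite -!/(eis _ _) eisB.
by exists (m - m'), (n - n').
Qed.

Lemma eisensteinM x y : eisenstein x -> eisenstein y -> eisenstein (x * y).
Proof.
move=> [m [n ->]] [m' [n' ->]]; rewrite -!/(eis _ _) eisM.
by eexists; eexists.
Qed.

Lemma eisensteinD x y : eisenstein x -> eisenstein y -> eisenstein (x + y).
Proof.
move=> Ex Ey; rewrite -[y]opprK -[- y]sub0r.
by apply: eisensteinB => //; apply: eisensteinB => //; apply: eisenstein0.
Qed.

Lemma eisenstein_nat (k : nat) : eisenstein (k%:R : R[i]).
Proof. by exists k%:Z, 0; rewrite mul0r addr0. Qed.

Lemma eisensteinX x k : eisenstein x -> eisenstein (x ^+ k).
Proof.
move=> Ex; elim: k => [|k IH]; first exact: eisenstein1.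
by rewrite exprS; apply: eisensteinM.
Qed.

Lemma sqn_eisenstein x : eisenstein x -> exists k : nat, sqn x = k%:R.
Proof.
move=> [m [n ->]]; rewrite -/(eis _ _) sqn_eis.
exists (absz (m ^+ 2 - m * n + n ^+ 2)).
have : 0 <= m ^+ 2 - m * n + n ^+ 2 by nia.
by case: (m ^+ 2 - m * n + n ^+ 2).
Qed.

(** From 4 (m^2 - m n + n^2) = (2 n - m)^2 + 3 m^2, and the same with m and n exchanged, both
    coordinates are controlled by the norm. *)
Lemma bounded_eisenstein x (N : nat) : eisenstein x -> `|x| <= N%:R ->
  exists m n, [/\ x = eis m n, (absz m <= N.*2)%N & (absz n <= N.*2)%N].
Proof.
move=> [m [n ->]]; rewrite -/(eis _ _) -[N%:R]normr_nat ler_norm_sqn sqn_eis.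
have -> : sqn (N%:R : R[i]) = (N%:Z ^+ 2)%:~R.
  rewrite -(rmorph_nat (real_complex R)) /sqn [complex.Re _]/= [complex.Im _]/=.
  by rewrite expr0n addr0 -natz expr2 intrM mulrz_nat.
rewrite ler_int => h; exists m, n.
have hm : m ^+ 2 <= 4 * N%:Z ^+ 2.
  by have := sqr_ge0 (2 * n - m); have := sqr_ge0 m; nia.
have hn : n ^+ 2 <= 4 * N%:Z ^+ 2.
  by have := sqr_ge0 (2 * m - n); have := sqr_ge0 n; nia.
by split => //; clear h; nia.
Qed.

Lemma eisenstein_field_divring : GRing.divring_closed (mem (@eisenstein_field R)).
Proof.
split.
- by rewrite inE => T [[+ _ _] _]; rewrite inE.
- move=> x y; rewrite !inE => Kx Ky T [[T1 TB TV] TE].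
  have := TB x y; rewrite !inE; apply; [exact: Kx|exact: Ky].
- move=> x y; rewrite !inE => Kx Ky T [[T1 TB TV] TE].
  have := TV x y; rewrite !inE; apply; [exact: Kx|exact: Ky].
Qed.

Local Notation K := (@eisenstein_field R).

Lemma sub_eisenstein_field x : eisenstein x -> K x.
Proof. by move=> Ex T [_]; apply. Qed.

Lemma eisenstein_fieldB x y : K x -> K y -> K (x - y).
Proof.
by case: eisenstein_field_divring => _ + _ => /(_ x y); rewrite !inE.
Qed.

Lemma eisenstein_field_div x y : K x -> K y -> K (x / y).
Proof.
by case: eisenstein_field_divring => _ _ /(_ x y); rewrite !inE.
Qed.

Lemma eisenstein_fieldD x y : K x -> K y -> K (x + y).
Proof.
move=> Kx Ky; rewrite -[y]opprK -[- y]sub0r.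
apply: eisenstein_fieldB => //; apply: eisenstein_fieldB => //.
by apply: sub_eisenstein_field; apply: eisenstein0.
Qed.

Lemma eisenstein_fieldV x : K x -> K x^-1.
Proof.
rewrite -div1r; apply: eisenstein_field_div.
by apply: sub_eisenstein_field; apply: eisenstein1.
Qed.

Lemma eisenstein_fieldM x y : K x -> K y -> K (x * y).
Proof.
move=> Kx Ky; rewrite -[y]invrK.
by apply: eisenstein_field_div => //; apply: eisenstein_fieldV.
Qed.

(** The fractions already form a division ring containing the Eisenstein integers, so minimality of
    the generated subfield applies. *)
Lemma eisenstein_field_frac x : K x ->
  exists u v, [/\ eisenstein u, eisenstein v, v != 0 & x = u / v].
Proof.
have E1 := eisenstein1; have E0 := eisenstein0.
apply: (smallest_sub (X := [set x | exists u v, [/\ eisenstein u,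
  eisenstein v, v != 0 & x = u / v]])); last first.
  by move=> y Ey; exists y, 1; split; rewrite ?oner_eq0 ?divr1.
split.
- by rewrite inE /=; exists 1, 1; split; rewrite ?oner_eq0 ?divr1.
- move=> x1 x2; rewrite !inE /=.
  move=> [u [v [Eu Ev v0 ->]]] [u' [v' [Eu' Ev' v0' ->]]].
  exists (u * v' - u' * v), (v * v'); split; last by field; rewrite v0 v0'.
  + by apply: eisensteinB; apply: eisensteinM.
  + exact: eisensteinM.
  + by rewrite mulf_neq0.
- move=> x1 x2; rewrite !inE /=.
  move=> [u [v [Eu Ev v0 ->]]] [u' [v' [Eu' Ev' v0' ->]]].
  (* When the divisor is 0, the quotient is 0 by the convention [0^-1 = 0]. *)
  have [->|u0'] := eqVneq u' 0.
    by exists 0, 1; split; rewrite ?oner_eq0 // !mul0r invr0 mulr0.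
  exists (u * v'), (v * u'); split; last by field; rewrite v0 v0' u0'.
  + exact: eisensteinM.
  + exact: eisensteinM.
  + by rewrite mulf_neq0.
Qed.

End Eisenstein.

Arguments eis {R} m n.

(** * Eisenstein digits of small norm *)

Section SmallDigits.
Variable R : realType.
Implicit Types (a b t u v w : R[i]).

Lemma sqn_rho : sqn (rho R) = 1.
Proof. by rewrite rhoE sqn_eis. Qed.

Lemma normX_rho k : `|rho R ^+ k| = 1.
Proof.
rewrite normrX; suff -> : `|rho R| = 1 by rewrite expr1n.
apply/eqP; rewrite -(@eqrXn2 _ 2) // ?normr_ge0 ?ler01 //.
by rewrite sqr_norm sqn_rho expr1n.
Qed.

Lemma rho_neq0 k : rho R ^+ k != 0.
Proof. by rewrite -normr_eq0 normX_rho oner_eq0. Qed.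

(** Both coordinates lie in [-2, 2]; the search leaves six elements, the rotations of j by powers of
    rho. *)
Lemma eisenstein_sqn3 a : eisenstein a -> sqn a = 3 ->
  exists2 k : nat, (k <= 5)%N & a = rho R ^+ k * jE R.
Proof.
move=> [m [n ->]]; rewrite -/(eis _ _) sqn_eis -[3 : R]/(3%:~R) => /intr_inj h.
have [hm1 hm2] : -2 <= m /\ m <= 2 by have := sqr_ge0 (2 * n - m); split; nia.
have [hn1 hn2] : -2 <= n /\ n <= 2 by have := sqr_ge0 (2 * m - n); split; nia.
have Em : m = -2 \/ m = -1 \/ m = 0 \/ m = 1 \/ m = 2 by lia.
have En : n = -2 \/ n = -1 \/ n = 0 \/ n = 1 \/ n = 2 by lia.
clear hm1 hm2 hn1 hn2; rewrite rhoE jEE.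
case: Em h => [|[|[|[|]]]] ->; case: En => [|[|[|[|]]]] -> h;
  try (by exfalso; lia).
- by exists 2%N; rewrite // !exprS expr0 ?mulr1 ?mul1r ?eisM.
- by exists 3%N; rewrite // !exprS expr0 ?mulr1 ?mul1r ?eisM.
- by exists 1%N; rewrite // !exprS expr0 ?mulr1 ?mul1r ?eisM.
- by exists 4%N; rewrite // !exprS expr0 ?mulr1 ?mul1r ?eisM.
- by exists 0%N; rewrite // expr0 ?mulr1 ?mul1r ?eisM.
- by exists 5%N; rewrite // !exprS expr0 ?mulr1 ?mul1r ?eisM.
Qed.

(** The norm form omits the value 2: it would force both coordinates into [-1, 1]. *)
Lemma eisenstein_sqn_gt1 a : eisenstein a -> 1 < sqn a ->
  sqn a = 3 \/ 4 <= sqn a.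
Proof.
move=> [m [n ->]]; rewrite -/(eis _ _) sqn_eis.
rewrite -[1 : R]/(1%:~R) -[3 : R]/(3%:~R) -[4 : R]/(4%:~R) ltr_int ler_int => h.
suff [->|] : m ^+ 2 - m * n + n ^+ 2 = 3 \/ 4 <= m ^+ 2 - m * n + n ^+ 2.
  by left.
  by right.
suff : m ^+ 2 - m * n + n ^+ 2 <> 2 by lia.
clear h => h.
have [hm1 hm2] : -1 <= m /\ m <= 1 by have := sqr_ge0 (2 * n - m); split; nia.
have [hn1 hn2] : -1 <= n /\ n <= 1 by have := sqr_ge0 (2 * m - n); split; nia.
have [E|[E|E]] : m = -1 \/ m = 0 \/ m = 1 by lia.
all: have [F|[F|F]] : n = -1 \/ n = 0 \/ n = 1 by lia.
all: by rewrite E F in h; lia.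
Qed.

(* For |j| = sqrt 3, the inequality |j u + 1| <= |u| says that u lies in the  *)
(* closed disc of centre j/2 and radius 1/2, so t is within 3/2 of j/2.       *)
Lemma eisenstein_near_half_j t v : eisenstein t -> 1 < sqn t -> `|v| < 1 ->
  `|jE R * (t + v) + 1| <= `|t + v| ->
  [\/ t = -1 + jE R, t = jE R | t = 1 + jE R].
Proof.
move=> [m [n ->]] + v1; rewrite -/(eis _ _) ler_norm_sqn => t1.
move eu : (eis m n + v) => u hu.
have {}hu : `|u - jE R / 2| <= `|2^-1 : R[i]|.
  rewrite ler_norm_sqn; move: hu (sqr_sqrt3 R).
  have -> : (2^-1 : R[i]) = (2^-1 : R)%:C.
    by rewrite fmorphV /= rmorph_nat.
  rewrite /sqn /jE; case: u eu => x y _ /=.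
  simpc => /=; set s := Num.sqrt 3 => h1 h2.
  nra.
have : `|eis m n - jE R / 2| < `|(3 / 2 : R[i])|.
  have -> : eis m n - jE R / 2 = (u - jE R / 2) - v by rewrite -eu; ring.
  apply: le_lt_trans (ler_normB _ _) _.
  rewrite (_ : 3 / 2 = 2^-1 + 1 :> R[i]); last by field.
  rewrite [ltRHS]ger0_norm ?addr_ge0 ?invr_ge0 ?ler0n //.
  by apply: ler_ltD => //; rewrite (le_trans hu) // ger0_norm // invr_ge0 ler0n.
rewrite ltr_norm_sqn.
(* With t = m + n omega, the bound 3/2 becomes the integer inequality (2 m - n)^2 + 3 (n - 1)^2 <
   9. *)
have -> : sqn (eis m n - jE R / 2) =
    ((2 * m - n) ^+ 2 + 3 * (n - 1) ^+ 2)%:~R / 4.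
  have -> : (2^-1 : R[i]) = (2^-1 : R)%:C by rewrite fmorphV /= rmorph_nat.
  rewrite eisE /jE /sqn; simpc => /=.
  rewrite !(intrD, intrM, intrB, exprS, expr0).
  have := sqr_sqrt3 R; set s := Num.sqrt 3 => h2.
  by field: h2.
have -> : sqn (3 / 2 : R[i]) = 9%:~R / 4.
  have -> : (3 / 2 : R[i]) = (3 / 2 : R)%:C.
    by rewrite rmorphM fmorphV /= !rmorph_nat.
  by rewrite /sqn /=; field.
rewrite ltr_pM2r ?invr_gt0 // ltr_int => h.
move: t1; rewrite sqn_eis -[1 : R]/(1%:~R) ltr_int => t1.
have [n1 n2] : 0 <= n /\ n <= 2.
  have : (n - 1) * (n - 1) < 3 by have := sqr_ge0 (2 * m - n); lia.
  by move=> hn; clear h t1; split; nia.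
(* The cases n = 0 and n = 1 leave only elements of norm at most 1, against [t1]; n = 2 yields the
   three listed values. *)
have [E|[E|E]] : n = 0 \/ n = 1 \/ n = 2 by lia.
- by subst n; exfalso; nia.
- subst n; exfalso.
  have h1 : (2 * m - 1) * (2 * m - 1) < 9 by lia.
  have [E|E] : m = 0 \/ m = 1 by clear h t1; nia.
  - by subst m; lia.
  - by subst m; lia.
have [m1 m2] : 0 <= m /\ m <= 2 by subst n; split; nia.
rewrite E jEE -[-1]/(- (1 : R[i])).
have -> : (1 : R[i]) = eis 1 0 by rewrite /eis mul0r addr0.
have -> : - eis 1 0 + eis 1 2 = eis 0 2 :> R[i] by rewrite addrC eisB.
have -> : eis 1 0 + eis 1 2 = eis 2 2 :> R[i] by rewrite /eis; ring.
have [->|[->|->]] : m = 0 \/ m = 1 \/ m = 2 by lia.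
- by constructor 1.
- by constructor 2.
- by constructor 3.
Qed.

(** Here w = b + v stands for a ratio of consecutive q's, and the last hypothesis says that the next
    ratio a + 1/w has norm at most 1. If |a| >= 2, then |a w + 1| >= 2 |w| - 1 > |w|; so a = rho^k
    j, and multiplying w by rho^k reduces to a = j. *)
Lemma digits_of_nondecrease a b v : eisenstein a -> eisenstein b ->
  1 < `|a| -> 1 < `|b| -> `|v| < 1 -> 1 < `|b + v| ->
  `|a * (b + v) + 1| <= `|b + v| ->
  exists k t, [/\ (k <= 5)%N, [\/ t = -1 + jE R, t = jE R | t = 1 + jE R],
    a = rho R ^+ k * jE R & b = rho R ^- k * t].
Proof.
move=> Ea Eb a1 b1 v1 w1 hw; rewrite !ltr1_norm_sqn in a1 b1.
have [a3|a4] := eisenstein_sqn_gt1 Ea a1; last first.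
  have a2 : 2 <= `|a|.
    rewrite -[leLHS]normr_nat ler_norm_sqn.
    by rewrite -(rmorph_nat (real_complex R)) /sqn /=; rewrite /sqn in a4; nra.
  have := lerB_normD (a * (b + v)) 1; rewrite normrM normr1 => h.
  have := le_trans h hw.
  have h2 : 2 * `|b + v| <= `|a| * `|b + v| by rewrite ler_wpM2r.
  rewrite lerBlDr => /(le_trans h2); rewrite mulrDl mul1r lerD2l.
  by move=> /(lt_le_trans w1); rewrite ltxx.
have [k k5 ak] := eisenstein_sqn3 Ea a3.
exists k, (rho R ^+ k * b); split => //; last by rewrite mulKf ?rho_neq0.
have E : rho R ^+ k * b + rho R ^+ k * v = rho R ^+ k * (b + v) by rewrite mulrDr.
apply: (@eisenstein_near_half_j _ (rho R ^+ k * v)).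
- apply: eisensteinM => //; apply: eisensteinX; rewrite rhoE.
  by exists 1, 1.
- by rewrite -ltr1_norm_sqn normrM normX_rho mul1r ltr1_norm_sqn.
- by rewrite normrM normX_rho mul1r.
- by rewrite E mulrCA mulrA -ak normrM normX_rho mul1r.
Qed.

End SmallDigits.

(** * The continued fraction algorithm and its Q-pair *)

Section Expansion.
Variables (R : realType) (f : R[i] -> R[i]).
Hypothesis f_eisenstein : forall zeta : R[i], eisenstein (f zeta).
Implicit Type z : R[i].

Local Notation K := (@eisenstein_field R).
Local Notation a z := (cf_digit f z).
Local Notation Z z := (cf_iter f z).
Local Notation P z := (Qp_shift (cf_digit f z)).
Local Notation Q z := (Qq_shift (cf_digit f z)).

Lemma Qp_shiftSS (b : nat -> R[i]) n :
  Qp_shift b n.+2 = b n.+1 * Qp_shift b n.+1 + Qp_shift b n.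
Proof. by []. Qed.

Lemma Qq_shiftSS (b : nat -> R[i]) n :
  Qq_shift b n.+2 = b n.+1 * Qq_shift b n.+1 + Qq_shift b n.
Proof. by []. Qed.

Lemma cf_iterS z n : Z z n.+1 = (Z z n - a z n)^-1.
Proof. by []. Qed.

Lemma cf_iterD z m n : Z z (m + n) = Z (Z z n) m.
Proof. by rewrite /cf_iter iterD. Qed.

Lemma eisenstein_Qp_shift z n : eisenstein (P z n).
Proof.
suff [] : eisenstein (P z n) /\ eisenstein (P z n.+1) by [].
elim: n => [|n [IH1 IH2]]; first by split; [apply: eisenstein1|apply: f_eisenstein].
split=> //; rewrite Qp_shiftSS; apply: eisensteinD => //.
by apply: eisensteinM => //; apply: f_eisenstein.
Qed.

Lemma eisenstein_Qq_shift z n : eisenstein (Q z n).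
Proof.
suff [] : eisenstein (Q z n) /\ eisenstein (Q z n.+1) by [].
elim: n => [|n [IH1 IH2]]; first by split; [apply: eisenstein0|apply: eisenstein1].
split=> //; rewrite Qq_shiftSS; apply: eisensteinD => //.
by apply: eisensteinM => //; apply: f_eisenstein.
Qed.

(** Each step of the recursion flips the sign of the determinant, which is -1 at the start because
    of the index shift. *)
Lemma Q_pair_det (b : nat -> R[i]) n :
  Qp_shift b n.+1 * Qq_shift b n - Qp_shift b n * Qq_shift b n.+1 = - (-1) ^+ n.
Proof.
elim: n => [|n IH]; first by rewrite /= mulr0 mulr1 sub0r.
by rewrite exprS -mulN1r -[(-1) ^+ n]opprK -IH Qp_shiftSS Qq_shiftSS; ring.
Qed.

(** Digits lie in [K], so membership in [K] would pass back from z_(n+1) to z_n. This keeps every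
    inversion away from 0 and puts z_n - a_n in [Phi f]. *)
Lemma cf_iter_irrational z n : ~ K z -> ~ K (Z z n).
Proof.
move=> Kz; elim: n => [//|n IH]; rewrite cf_iterS => /eisenstein_fieldV.
rewrite invrK => h; apply: IH; rewrite -[Z z n](subrK (a z n)).
by apply: eisenstein_fieldD => //; apply: sub_eisenstein_field; apply: f_eisenstein.
Qed.

Lemma irrational_neq0 z : ~ K z -> z != 0.
Proof.
move=> Kz; apply/eqP => z0; apply: Kz; rewrite z0.
exact: sub_eisenstein_field (eisenstein0 R).
Qed.

Lemma cf_iter_PhiV z n : ~ K z -> set_inv (Phi f) (Z z n.+1).
Proof.
move=> Kz; exists (Z z n - a z n); last by [].
by exists (Z z n) => //; apply: cf_iter_irrational.
Qed.

Lemma cf_iter_recE z n : ~ K z -> Z z n = a z n + (Z z n.+1)^-1.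
Proof. by move=> Kz; rewrite cf_iterS invrK addrC subrK. Qed.

(** This is the division-free form of z = (p_n z_(n+1) + p_(n-1)) / (q_n z_(n+1) + q_(n-1)). *)
Lemma cf_iter_Q_pair z n : ~ K z ->
  Z z n.+1 * (Q z n.+1 * z - P z n.+1) + (Q z n * z - P z n) = 0.
Proof.
move=> Kz; elim: n => [|n IH].
  rewrite cf_iterS /= mul1r mul0r sub0r mulVf ?subrr //.
  by have := irrational_neq0 (cf_iter_irrational (n := 1) Kz); rewrite invr_eq0.
have Z0 m : Z z m != 0 := irrational_neq0 (cf_iter_irrational Kz).
(* The induction hypothesis is multiplied by z_(n+2), with z_(n+1) = a_(n+1) + 1 / z_(n+2). *)
rewrite -[RHS](mulr0 (Z z n.+2)) -{}IH Qp_shiftSS Qq_shiftSS.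
by rewrite (cf_iter_recE n.+1 Kz); field; rewrite Z0.
Qed.

End Expansion.

(** * Growth of the denominators and convergence *)

Section Convergence.
Variables (R : realType) (f : R[i] -> R[i]) (r : R).
Hypotheses (f_eisenstein : forall zeta : R[i], eisenstein (f zeta))
  (r_gt0 : 0 < r) (r_lt1 : r < 1)
  (Phi_ball : Phi f `<=` ball (0 : R[i]^o) r%:C)
  (f_gt1 : forall zeta : R[i], set_inv (Phi f) zeta -> 1 < `|f zeta|)
  (f_disjoint : forall (k : nat) (t : R[i]), (k <= 5)%N ->
     [\/ t = -1 + jE R, t = jE R | t = 1 + jE R] ->
     set_translate (rho R ^- k * t) (set_inv (Cset f (rho R ^+ k * jE R)))
       `&` (Cset f (rho R ^- k * t) `&` set_inv (Phi f)) = set0).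
Implicit Type z : R[i].

Local Notation K := (@eisenstein_field R).
Local Notation a z := (cf_digit f z).
Local Notation Z z := (cf_iter f z).
Local Notation P z := (Qp_shift (cf_digit f z)).
Local Notation Q z := (Qq_shift (cf_digit f z)).

Lemma Q_pair_increasing z n : ~ K z -> `|Q z n| < `|Q z n.+1|.
Proof.
move=> Kz; have a1 m : 1 < `|a z m.+1| by apply: f_gt1; apply: cf_iter_PhiV.
(* The induction carries two consecutive inequalities: the first gives |v| < 1, the second |a_(n+1)
   + v| > 1. *)
suff [] : `|Q z n| < `|Q z n.+1| /\ `|Q z n.+1| < `|Q z n.+2| by [].
elim: n => [|n [lt01 lt12]].
  by rewrite /= normr0 normr1 mulr1 addr0; split.
split=> //; rewrite real_ltNge ?normr_real //; apply/negP => le32.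
have q1 : 0 < `|Q z n.+1| by apply: le_lt_trans lt01.
have q1' : Q z n.+1 != 0 by rewrite -normr_gt0.
pose v := Q z n / Q z n.+1.
have wE : a z n.+1 + v = Q z n.+2 / Q z n.+1.
  by rewrite Qq_shiftSS /v; field.
have [|||||||k [t [k5 ht ak at']]] :=
    @digits_of_nondecrease R (a z n.+2) (a z n.+1) v.
- exact: f_eisenstein.
- exact: f_eisenstein.
- exact: a1.
- exact: a1.
- by rewrite normf_div ltr_pdivrMr // mul1r.
- by rewrite wE normf_div ltr_pdivlMr // mul1r.
- rewrite wE.
  have -> : a z n.+2 * (Q z n.+2 / Q z n.+1) + 1 = Q z n.+3 / Q z n.+1.
    by rewrite [Q z n.+3]Qq_shiftSS; field.
  by rewrite !normf_div ler_pM2r ?invr_gt0.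
(* The point z_(n+1) = a_(n+1) + 1 / z_(n+2) lies in both sets of condition (c): its digit is rho^-k
   t, and that of z_(n+2) is rho^k j. *)
have := f_disjoint k5 ht; rewrite -subset0 => /(_ (Z z n.+1)); apply; split.
  exists (Z z n.+2)^-1; last by rewrite -at' -cf_iter_recE.
  by exists (Z z n.+2).
by split; [exact: at'|apply: cf_iter_PhiV].
Qed.

Lemma Q_pair_neq0 z n : ~ K z -> Q z n.+1 != 0.
Proof.
by move=> Kz; rewrite -normr_gt0; apply: le_lt_trans (Q_pair_increasing n Kz).
Qed.

(** Squared norms of Eisenstein integers are natural numbers, so each strict increase gains at least
    1. *)
Lemma Q_pair_sqn_ge z n : ~ K z -> n%:R <= sqn (Q z n).
Proof.
move=> Kz; elim: n => [|n IH]; first by rewrite addr_ge0 ?sqr_ge0.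
have := Q_pair_increasing n Kz; rewrite ltr_norm_sqn.
have [k1 E1] := sqn_eisenstein (eisenstein_Qq_shift f_eisenstein z n).
have [k2 E2] := sqn_eisenstein (eisenstein_Qq_shift f_eisenstein z n.+1).
by move: IH; rewrite E1 E2 !ler_nat ltr_nat; apply: leq_ltn_trans.
Qed.

Lemma Q_pair_norm_ge1 z n : ~ K z -> 1 <= `|Q z n.+1|.
Proof.
move=> Kz; rewrite -[leLHS]normr1 ler_norm_sqn sqn1.
by apply: le_trans (Q_pair_sqn_ge n.+1 Kz); rewrite ler1n.
Qed.

Lemma cf_iter_norm_gt z n : ~ K z -> (r^-1)%:C < `|Z z n.+1|.
Proof.
move=> Kz; rewrite cf_iterS normfV fmorphV /= ltf_pV2 ?posrE.
- have /Phi_ball : Phi f (Z z n - a z n).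
    by exists (Z z n) => //; apply: cf_iter_irrational.
  by rewrite -ball_normE /= sub0r normrN.
- by rewrite ltcR.
- rewrite normr_gt0 -invr_eq0; apply: irrational_neq0.
  exact: (cf_iter_irrational f_eisenstein (n := n.+1) Kz).
Qed.

Lemma Q_pair_error z n : ~ K z ->
  `|Q z n.+1 * z - P z n.+1| <= (r / (1 - r))%:C / `|Q z n.+1|.
Proof.
move=> Kz; have q0 : 0 < `|Q z n.+1| by rewrite normr_gt0 Q_pair_neq0.
set e := Q z n.+1 * z - P z n.+1.
(* Obtained from [cf_iter_Q_pair] times q_n together with the determinant. *)
have E : (Q z n.+1 * Z z n.+1 + Q z n) * e = (-1) ^+ n.
  have := cf_iter_Q_pair f_eisenstein n Kz.
  move/(congr1 (fun x => Q z n.+1 * x)); rewrite mulr0 -/e => h.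
  rewrite -[RHS]opprK -(Q_pair_det (a z)) -[LHS]subr0 -h /e; ring.
have c0 : 0 < 1 - r by rewrite subr_gt0.
(* Since |z_(n+1)| > 1/r and |q_(n-1)| < |q_n|, the first factor of [E] is at least (1/r - 1) |q_n|;
   this is the source of the constant r / (1 - r). *)
have low : (r / (1 - r))%:C^-1 * `|Q z n.+1| <= `|Q z n.+1 * Z z n.+1 + Q z n|.
  have := lerB_normD (Q z n.+1 * Z z n.+1) (Q z n).
  apply: le_trans; rewrite normrM.
  have -> : (r / (1 - r))%:C^-1 = (r^-1)%:C - 1.
    rewrite -fmorphV -[1 in RHS](rmorph1 (real_complex R)) -rmorphB /=.
    by congr (_%:C); field; rewrite !gt_eqF.
  rewrite mulrBl mul1r; apply: lerB; last exact/ltW/Q_pair_increasing.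
  by rewrite mulrC ler_pM2l // ltW // cf_iter_norm_gt.
have D0 : 0 < (r / (1 - r))%:C by rewrite ltcR divr_gt0.
have := congr1 (fun x => `|x|) E; rewrite normrM normrX normrN1 expr1n => E1.
have := ler_wpM2r (normr_ge0 e) low; rewrite E1.
by rewrite -mulrA ler_pdivrMl // mulr1 ler_pdivlMr // mulrC.
Qed.

Lemma convergent_error z n : ~ K z ->
  `|z - P z n.+1 / Q z n.+1| <= (r / (1 - r))%:C * `|Q z n.+1| ^- 2.
Proof.
move=> Kz; have q0 := Q_pair_neq0 n Kz.
have -> : z - P z n.+1 / Q z n.+1 = (Q z n.+1 * z - P z n.+1) / Q z n.+1.
  by field.
rewrite normf_div expr2 invfM mulrA ler_pM2r ?invr_gt0 ?normr_gt0 //.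
exact: Q_pair_error.
Qed.

Lemma convergents_cvg z : ~ K z ->
  (fun n => P z n.+1 / Q z n.+1) @ \oo --> (z : R[i]^o).
Proof.
move=> Kz; apply/(@cvgrPdist_lt _ R[i]^o) => eps eps0.
(* A positive element of [R[i]] is real, so the estimate can be carried out in [R]. *)
have epsE : eps = (complex.Re eps)%:C by rewrite RRe_real // gtr0_real.
rewrite epsE ltcR in eps0.
have D0 : 0 < r / (1 - r) by rewrite divr_gt0 ?subr_gt0.
near=> n.
apply: le_lt_trans (convergent_error n Kz) _.
rewrite sqr_norm -fmorphV -rmorphM /= epsE ltcR.
have n0 : 0 < n.+1%:R :> R by [].
(* As |q_n|^2 >= n + 1, any n beyond r / (1 - r) / eps suffices. *)
have qn := Q_pair_sqn_ge n.+1 Kz.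
rewrite ltr_pdivrMr ?(lt_le_trans n0) //.
apply: lt_le_trans (ler_wpM2l (ltW eps0) qn).
rewrite -ltr_pdivrMl //.
apply: (@lt_le_trans _ _ (n%:R : R)); last by rewrite ler_nat.
by near: n; apply: nbhs_infty_gtr.
Unshelve. all: by end_near.
Qed.

(** The digits determine the convergents, and limits are unique. *)
Lemma cf_digit_inj z w : ~ K z -> ~ K w -> a z =1 a w -> z = w.
Proof.
move=> Kz Kw /funext E; have cz := convergents_cvg Kz.
have cw := convergents_cvg Kw; rewrite -E in cw.
exact: (cvg_unique (@norm_hausdorff _ R[i]^o) cz cw).
Qed.

End Convergence.

(** * Finiteness tools and quadratic surds over [K] *)

Lemma pigeonhole_nat (T : finType) (X : Type) (u : nat -> X) (g : T -> X) :
  (forall n, exists d, u n = g d) -> exists m n, (m < n)%N /\ u m = u n.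
Proof.
move=> /choice[h hu]; apply: contrapT => H.
(* The chosen preimages [h] cannot be distinct on [#|T|.+1] indices. *)
suff /leq_card : injective (fun i : 'I_#|T|.+1 => h i) by rewrite card_ord ltnn.
move=> i j E; apply: val_inj => /=.
have [ij|ji|//] := ltngtP i j; exfalso; apply: H.
- by exists i, j; rewrite ij !hu E.
- by exists j, i; rewrite ji !hu E.
Qed.

Section QuadraticSurds.
Variable R : realType.
Implicit Types z w : R[i].
Local Notation K := (@eisenstein_field R).

Lemma finite_bounded_eisenstein (N : nat) :
  exists (T : finType) (e : T -> R[i]),
    forall x, eisenstein x -> `|x| <= N%:R -> exists t, x = e t.
Proof.
(* Coordinates in [-2N, 2N], shifted by 2N, are ordinals below 4N + 1. *)
pose I := 'I_(N.*2.*2.+1).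
exists (I * I)%type.
exists (fun t : I * I => eis ((t.1 : nat)%:Z - N.*2%:Z) ((t.2 : nat)%:Z - N.*2%:Z))
  => x Ex xN.
have [m [n [-> hm hn]]] := bounded_eisenstein Ex xN.
have lt k : (absz k <= N.*2)%N -> (absz (k + N.*2%:Z)%R < N.*2.*2.+1)%N by lia.
exists (Ordinal (lt m hm), Ordinal (lt n hn)) => /=.
by congr (eis _ _); lia.
Qed.

Lemma ge0_le_nat z : 0 <= z -> exists N : nat, z <= N%:R.
Proof.
move=> z0; exists (Num.trunc (complex.Re z)).+1.
rewrite -(RRe_real (ger0_real z0)) -(rmorph_nat (real_complex R)) lecR.
exact/ltW/truncnS_gt.
Qed.

Lemma quadratic_surdP z : quadratic_surd K z <-> ~ K z /\
  exists A B C, [/\ K A, K B & K C] /\ A != 0 /\ A * z ^+ 2 + B * z + C = 0.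
Proof.
split=> -[Kz]; last first.
  move=> [A [B [C [[KA KB KC] [A0 E]]]]]; split=> //.
  exists (Poly [:: C; B; A]).
  have PE : Poly [:: C; B; A] = [:: C; B; A] :> seq _ by rewrite (@PolyK _ 0).
  split; first by rewrite PE.
    rewrite PE => -[|[|[|i]]] //=; rewrite nth_nil.
    exact: sub_eisenstein_field (eisenstein0 R).
  by rewrite rootE horner_Poly /= mul0r add0r -E; apply/eqP; ring.
move=> [p [p3 Kp /rootP]].
rewrite horner_coef p3 !big_ord_recl big_ord0 /= => E; split=> //.
exists p`_2, p`_1, p`_0; split; first by split; apply: Kp.
split; last by rewrite -[RHS]E /bump /=; ring.
by have := lead_coef_eq0 p; rewrite /lead_coef p3 /= -size_poly_eq0 p3 => ->.
Qed.

(** The coefficients are fractions of Eisenstein integers; multiplying by [v1 * v2 * v3] clears the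
    denominators. *)
Lemma quadratic_surd_eisenstein z : quadratic_surd K z ->
  exists A B C, [/\ eisenstein A, eisenstein B & eisenstein C] /\
    A != 0 /\ A * z ^+ 2 + B * z + C = 0.
Proof.
move=> /quadratic_surdP[_ [A [B [C [[]]]]]].
move=> /eisenstein_field_frac[u1 [v1 [Eu1 Ev1 v10 ->]]].
move=> /eisenstein_field_frac[u2 [v2 [Eu2 Ev2 v20 ->]]].
move=> /eisenstein_field_frac[u3 [v3 [Eu3 Ev3 v30 ->]]] [u10 E].
exists (u1 * v2 * v3), (u2 * v1 * v3), (u3 * v1 * v2); split.
  by split; do 2![apply: eisensteinM => //].
split; first by move: u10; rewrite !mulf_eq0 invr_eq0 !negb_or v20 v30 v10 !andbT.
rewrite -[RHS](mulr0 (v1 * v2 * v3)) -E; field.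
by rewrite v10 v20 v30.
Qed.

(** Substitute X - a for X in the equation of z. *)
Lemma quadratic_surdD a z : K a -> quadratic_surd K z -> quadratic_surd K (a + z).
Proof.
move=> Ka /quadratic_surdP[Kz [A [B [C [[KA KB KC] [A0 E]]]]]].
apply/quadratic_surdP; split.
  by move=> h; apply: Kz; rewrite -[z](addKr a) addrC; apply: eisenstein_fieldB.
exists A, (B - 2 * A * a), (A * a ^+ 2 - B * a + C); split; last first.
  by split=> //; rewrite -[RHS]E; ring.
have K2 : K 2 by apply: sub_eisenstein_field; apply: eisenstein_nat.
split=> //.
- by apply: eisenstein_fieldB => //; do 2![apply: eisenstein_fieldM => //].
- apply: eisenstein_fieldD => //; apply: eisenstein_fieldB.
    by apply: eisenstein_fieldM => //; apply: eisenstein_fieldM.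
  exact: eisenstein_fieldM.
Qed.

(** Reverse the coefficients; C = 0 would give z = - B / A in [K], as z is nonzero. *)
Lemma quadratic_surdV z : quadratic_surd K z -> quadratic_surd K z^-1.
Proof.
move=> /quadratic_surdP[Kz [A [B [C [[KA KB KC] [A0 E]]]]]].
have z0 := irrational_neq0 Kz.
apply/quadratic_surdP; split.
  by move=> /eisenstein_fieldV; rewrite invrK.
exists C, B, A; split=> //; split; last first.
  by rewrite -[RHS](mul0r (z ^- 2)) -E; field.
apply/eqP => C0; apply: Kz.
have -> : z = 0 - B / A.
  apply: (mulfI z0); apply: (mulfI A0).
  apply/eqP; rewrite -subr_eq0; apply/eqP; rewrite -[RHS]E C0; field.
  exact: A0.
apply: eisenstein_fieldB; last exact: eisenstein_field_div.
exact: sub_eisenstein_field (eisenstein0 R).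
Qed.

End QuadraticSurds.

(** * Lagrange's theorem: quadratic surds and periodic digits *)

Section Lagrange.
Variables (R : realType) (f : R[i] -> R[i]) (r : R).
Hypotheses (f_eisenstein : forall zeta : R[i], eisenstein (f zeta))
  (r_gt0 : 0 < r) (r_lt1 : r < 1)
  (Phi_ball : Phi f `<=` ball (0 : R[i]^o) r%:C)
  (f_gt1 : forall zeta : R[i], set_inv (Phi f) zeta -> 1 < `|f zeta|)
  (f_disjoint : forall (k : nat) (t : R[i]), (k <= 5)%N ->
     [\/ t = -1 + jE R, t = jE R | t = 1 + jE R] ->
     set_translate (rho R ^- k * t) (set_inv (Cset f (rho R ^+ k * jE R)))
       `&` (Cset f (rho R ^- k * t) `&` set_inv (Phi f)) = set0).
Variables (z : R[i]).
Hypothesis Kz : ~ @eisenstein_field R z.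

Local Notation K := (@eisenstein_field R).
Local Notation a := (cf_digit f z).
Local Notation Z := (cf_iter f z).
Local Notation P := (Qp_shift (cf_digit f z)).
Local Notation Q := (Qq_shift (cf_digit f z)).

Lemma quadratic_surd_of_cf_iter n :
  quadratic_surd K (Z n) -> quadratic_surd K z.
Proof.
elim: n => [//|n IH] h; apply: IH; rewrite (cf_iter_recE f n Kz).
apply: quadratic_surdD; last exact: quadratic_surdV.
by apply: sub_eisenstein_field; apply: f_eisenstein.
Qed.

Lemma quadratic_surd_of_periodic : eventually_periodic a -> quadratic_surd K z.
Proof.
move=> [n0 [m [m0 per]]]; apply: (@quadratic_surd_of_cf_iter n0).
set w := Z n0; have Kw : ~ K w by apply: cf_iter_irrational.
(* By periodicity both sides have the same digits. *)
have wE : w = cf_iter f w m.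
  apply: (cf_digit_inj f_eisenstein r_gt0 r_lt1 Phi_ball f_gt1 f_disjoint) => //.
    exact: cf_iter_irrational.
  move=> n; rewrite /cf_digit /w -!cf_iterD.
  have := per (n + n0)%N (leq_addl _ _); rewrite /cf_digit => <-.
  by congr (f (Z _)); lia.
case: m m0 wE {per} => // m _ wE.
(* Putting w for its own iterate makes this identity a quadratic equation for w, with a nonzero
   denominator as leading coefficient. *)
have := cf_iter_Q_pair f_eisenstein m Kw; rewrite -wE => E.
have EP n : K (Qp_shift (cf_digit f w) n).
  by apply: sub_eisenstein_field; apply: eisenstein_Qp_shift.
have EQ n : K (Qq_shift (cf_digit f w) n).
  by apply: sub_eisenstein_field; apply: eisenstein_Qq_shift.
apply/quadratic_surdP; split=> //.
exists (Qq_shift (cf_digit f w) m.+1).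
exists (Qq_shift (cf_digit f w) m - Qp_shift (cf_digit f w) m.+1).
exists (0 - Qp_shift (cf_digit f w) m); split; first split=> //.
- exact: eisenstein_fieldB.
- apply: eisenstein_fieldB => //.
  exact: sub_eisenstein_field (eisenstein0 R).
- split; last by rewrite -[RHS]E; ring.
  exact: (Q_pair_neq0 f_eisenstein f_gt1 f_disjoint).
Qed.

Section Coefficients.
Variables A B C : R[i].
Hypotheses (EA : eisenstein A) (EB : eisenstein B) (EC : eisenstein C)
  (A0 : A != 0) (zE : A * z ^+ 2 + B * z + C = 0).

(* Z n.+1 is a root of qlead n.+1 'X^2 + qmid n 'X + qlead n, the transform   *)
(* of A 'X^2 + B 'X + C by the matrix of the n-th convergents.                *)
Definition qlead n := A * P n ^+ 2 + B * P n * Q n + C * Q n ^+ 2.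
Definition qmid n := 2 * A * P n.+1 * P n + B * (P n.+1 * Q n + P n * Q n.+1)
  + 2 * C * Q n.+1 * Q n.

Lemma eisenstein_qlead n : eisenstein (qlead n).
Proof.
have EP := eisenstein_Qp_shift f_eisenstein z n.
have EQ := eisenstein_Qq_shift f_eisenstein z n.
rewrite /qlead !expr2.
by repeat first [exact: EP | exact: EQ | assumption
  | apply: eisensteinD | apply: eisensteinM].
Qed.

Lemma eisenstein_qmid n : eisenstein (qmid n).
Proof.
have EP := eisenstein_Qp_shift f_eisenstein z.
have EQ := eisenstein_Qq_shift f_eisenstein z.
have E2 := eisenstein_nat R 2.
by rewrite /qmid; repeat first [exact: EP | exact: EQ | assumption
  | apply: eisensteinD | apply: eisensteinM].
Qed.

(** Substitute the expression of z through z_(n+1) into the equation of z and clear denominators. *)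
Lemma cf_iter_root n : qlead n.+1 * Z n.+1 ^+ 2 + qmid n * Z n.+1 + qlead n = 0.
Proof.
have E := cf_iter_Q_pair f_eisenstein n Kz.
have zd : P n.+1 * Z n.+1 + P n = z * (Q n.+1 * Z n.+1 + Q n).
  by apply/eqP; rewrite -subr_eq0 -oppr_eq0 -[eqbRHS]E; apply/eqP; ring.
transitivity (A * (P n.+1 * Z n.+1 + P n) ^+ 2
  + B * (P n.+1 * Z n.+1 + P n) * (Q n.+1 * Z n.+1 + Q n)
  + C * (Q n.+1 * Z n.+1 + Q n) ^+ 2); first by rewrite /qlead /qmid; ring.
by rewrite zd -[RHS](mul0r ((Q n.+1 * Z n.+1 + Q n) ^+ 2)) -zE; ring.
Qed.

(** The substitution has determinant 1 or -1, so it preserves the discriminant. *)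
Lemma qdisc n : qmid n ^+ 2 - 4 * qlead n.+1 * qlead n = B ^+ 2 - 4 * A * C.
Proof.
transitivity ((B ^+ 2 - 4 * A * C) * (P n.+1 * Q n - P n * Q n.+1) ^+ 2).
  by rewrite /qmid /qlead; ring.
by rewrite Q_pair_det sqrrN -exprM mulnC exprM sqrrN expr1n expr1n mulr1.
Qed.

(** Both squares equal the common discriminant. Hence the coefficients determine z_(n+1) up to the
    sign of the fixed number 2 A z + B. *)
Lemma qdisc_root n : (2 * qlead n.+1 * Z n.+1 + qmid n) ^+ 2 = (2 * A * z + B) ^+ 2.
Proof.
transitivity (qmid n ^+ 2 - 4 * qlead n.+1 * qlead n + 4 * qlead n.+1
   * (qlead n.+1 * Z n.+1 ^+ 2 + qmid n * Z n.+1 + qlead n)); first by ring.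
by rewrite cf_iter_root qdisc mulr0 -(mulr0 (4 * A)) -zE; ring.
Qed.

(** Otherwise the equation degenerates: if [qmid n] is nonzero, z_(n+1) lies in [K]; if not, the
    discriminant vanishes and z = - B / (2 A) lies in [K]. *)
Lemma qlead_neq0 n : qlead n.+1 != 0.
Proof.
have Kl m : K (qlead m) by apply: sub_eisenstein_field; apply: eisenstein_qlead.
have Km m : K (qmid m) by apply: sub_eisenstein_field; apply: eisenstein_qmid.
have K0 : K 0 := sub_eisenstein_field (eisenstein0 R).
have K2 : K 2 := sub_eisenstein_field (eisenstein_nat R 2).
apply/eqP => l0; have [m0|m0] := eqVneq (qmid n) 0.
  have := qdisc_root n; rewrite l0 m0 mulr0 mul0r addr0 expr0n /=.
  move=> /esym/eqP; rewrite sqrf_eq0 => /eqP E; apply: Kz.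
  have -> : z = (0 - B) / (2 * A).
    by rewrite -E; field; rewrite A0.
  apply: eisenstein_field_div.
    by apply: eisenstein_fieldB => //; apply: sub_eisenstein_field.
  by apply: eisenstein_fieldM => //; apply: sub_eisenstein_field.
have := cf_iter_root n; rewrite l0 mul0r add0r => E.
apply: (cf_iter_irrational f_eisenstein (n := n.+1) Kz).
have -> : Z n.+1 = (0 - qlead n) / qmid n by rewrite -E; field.
by apply: eisenstein_field_div => //; apply: eisenstein_fieldB.
Qed.

Lemma qlead_bounded : exists N : nat, forall n, `|qlead n.+1| <= N%:R.
Proof.
pose D : R[i] := (r / (1 - r))%:C.
have D0 : 0 <= D by rewrite lecR divr_ge0 // ?subr_ge0 ltW.
have [|N hN] := @ge0_le_nat R (`|2 * A * z + B| * D + `|A| * D ^+ 2).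
  by rewrite addr_ge0 // mulr_ge0 // exprn_ge0.
exists N => n; apply: le_trans hN.
pose e := Q n.+1 * z - P n.+1.
have he : `|e| <= D / `|Q n.+1|.
  exact: (Q_pair_error f_eisenstein r_gt0 r_lt1 Phi_ball f_gt1 f_disjoint).
have q1 : 1 <= `|Q n.+1|.
  exact: (Q_pair_norm_ge1 f_eisenstein f_gt1 f_disjoint).
have q0 : 0 < `|Q n.+1| by apply: lt_le_trans q1.
have eD : `|e| <= D.
  by apply: le_trans he _; rewrite ler_pdivrMr // ler_peMr.
have qeD : `|Q n.+1 * e| <= D.
  by rewrite normrM mulrC -ler_pdivlMr.
(* Expand at p_n = q_n z - e: the q_n^2 term vanishes by the equation of z, and both e and q_n e are
   bounded. *)
have -> : qlead n.+1 = A * e ^+ 2 - (2 * A * z + B) * (Q n.+1 * e).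
  transitivity (A * e ^+ 2 - (2 * A * z + B) * (Q n.+1 * e)
     + Q n.+1 ^+ 2 * (A * z ^+ 2 + B * z + C)).
    by rewrite /qlead /e; ring.
  by rewrite zE mulr0 addr0.
apply: le_trans (ler_normB _ _) _.
rewrite addrC normrM [`|A * _|]normrM normrX; apply: lerD.
  by apply: ler_wpM2l.
by apply: ler_wpM2l => //; apply: lerXn2r; rewrite ?nnegrE.
Qed.

Lemma qmid_bounded : exists N : nat, forall n, `|qmid n.+1| <= N%:R.
Proof.
have [M hM] := qlead_bounded.
have [|N hN] := @ge0_le_nat R (`|B ^+ 2 - 4 * A * C| + 4 * M%:R * M%:R + 1).
  by rewrite !addr_ge0 // !mulr_ge0.
exists N => n; apply: le_trans hN.
set x := qmid n.+1.
have x2 : `|x| ^+ 2 <= `|B ^+ 2 - 4 * A * C| + 4 * M%:R * M%:R.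
  rewrite -normrX; have <- : B ^+ 2 - 4 * A * C + 4 * qlead n.+2 * qlead n.+1 = x ^+ 2.
    by rewrite -(qdisc n.+1) subrK.
  apply: le_trans (ler_normD _ _) _; rewrite lerD2l !normrM normr_nat.
  by rewrite -!mulrA ler_wpM2l // ler_pM.
(* The extra 1 in the bound covers |x| <= 1, where |x| need not be at most |x|^2. *)
have [x1|x1] := real_leP (normr_real x) (real1 _).
  by apply: le_trans x1 _; rewrite lerDr addr_ge0 // !mulr_ge0.
apply: le_trans (le_trans _ x2) _; last by rewrite lerDl.
by rewrite expr2 ler_peMl // ltW.
Qed.

Lemma periodic_of_root : eventually_periodic a.
Proof.
have [N1 h1] := qlead_bounded; have [N2 h2] := qmid_bounded.
have [T1 [e1 H1]] := finite_bounded_eisenstein R N1.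
have [T2 [e2 H2]] := finite_bounded_eisenstein R N2.
pose s := 2 * A * z + B.
(* The quadratic formula: two coefficients from finite sets and a sign recover the iterate. *)
pose g (d : T1 * T2 * bool) : R[i] :=
  ((if d.2 then s else - s) - e2 d.1.2) / (2 * e1 d.1.1).
(* Starting at index 2 puts [qlead n.+2] and [qmid n.+1] within the bounds. *)
have [n|m [n [mn E]]] := @pigeonhole_nat _ _ (fun n => Z n.+2) g.
  have [t1 E1] := H1 _ (eisenstein_qlead n.+2) (h1 n.+1).
  have [t2 E2] := H2 _ (eisenstein_qmid n.+1) (h2 n).
  have := qlead_neq0 n.+1; have /eqP := qdisc_root n.+1.
  rewrite E1 E2 eqf_sqr; set w := Z n.+2 => + l0.
  case/orP => /eqP e.
  - exists (t1, t2, true); rewrite /g /= /s -e; field.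
    by rewrite l0.
  - exists (t1, t2, false); rewrite /g /= /s -e; field.
    by rewrite l0.
(* Equal iterates have equal continuations, so the digits repeat from index m + 2 on. *)
exists m.+2, (n - m)%N; split; first by rewrite subn_gt0.
move=> k mk; rewrite /cf_digit; congr (f _).
rewrite -(subnK mk) (_ : (_ + (n - m) = (k - m.+2) + n.+2)%N); last by lia.
by rewrite !cf_iterD -E.
Qed.

End Coefficients.

End Lagrange.

Theorem theorem5p1 (R : realType) (f : R[i] -> R[i]) (r : R)
    (f_eisenstein : forall zeta : R[i], eisenstein (f zeta))
    (f_near : forall zeta : R[i], `|zeta - f zeta| <= 1)
    (r_gt0 : 0 < r) (r_lt1 : r < 1)
    (Phi_ball : Phi f `<=` ball (0 : R[i]^o) r%:C)
    (f_gt1 : forall zeta : R[i], set_inv (Phi f) zeta -> 1 < `|f zeta|)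
    (f_disjoint : forall (k : nat) (t : R[i]), (k <= 5)%N ->
       [\/ t = -1 + jE R, t = jE R | t = 1 + jE R] ->
       set_translate (rho R ^- k * t) (set_inv (Cset f (rho R ^+ k * jE R)))
         `&` (Cset f (rho R ^- k * t) `&` set_inv (Phi f)) = set0)
    (z : R[i]) (z_notin : ~ @eisenstein_field R z) :
  let a := cf_digit f z in
  let p := Qp a in
  let q := Qq a in
  [/\ (forall n : nat, (1 <= n)%N -> `|q n.-1| < `|q n|) /\
        (forall n : nat, q n != 0),
      ((fun n => p n / q n) @ \oo --> (z : R[i]^o)) /\
        (forall n : nat,
           `|z - p n / q n| <= (r / (1 - r))%:C * `|q n| ^- 2)
    & quadratic_surd (@eisenstein_field R) z <-> eventually_periodic a].
Proof.
split.
- split=> [[//|n] _|n]; first exact: (Q_pair_increasing f_eisenstein f_gt1 f_disjoint).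
  exact: (Q_pair_neq0 f_eisenstein f_gt1 f_disjoint).
- split=> [|n].
    exact: (convergents_cvg f_eisenstein r_gt0 r_lt1 Phi_ball f_gt1 f_disjoint).
  exact: (convergent_error f_eisenstein r_gt0 r_lt1 Phi_ball f_gt1 f_disjoint).
- split=> [/quadratic_surd_eisenstein|].
    move=> [A [B [C [[EA EB EC] [A0 zE]]]]].
    exact: (periodic_of_root f_eisenstein r_gt0 r_lt1 Phi_ball f_gt1 f_disjoint
              z_notin EA EB EC A0 zE).
  exact: (quadratic_surd_of_periodic f_eisenstein r_gt0 r_lt1 Phi_ball f_gt1
            f_disjoint).
Qed.
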